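(* Let $\mathcal{H}=\mathcal{H}_1\otimes\mathcal{H}_2\otimes\mathcal{H}_3$ with $\dim\mathcal{H}_i=d_i$. For every unitary $U\in U(d_1d_2d_3)$ acting on $\mathcal{H}$ and every $ab|c\in\{12|3,13|2,23|1\}$ one has $\epsilon_{ab|c}(U)\le\tilde\epsilon_{ab|c}$, and consequently $\epsilon_1(U)\le\tilde\epsilon_1:=\frac13(\tilde\epsilon_{12|3}+\tilde\epsilon_{13|2}+\tilde\epsilon_{23|1})$, where $$\tilde\epsilon_{ab|c}:=2-2\Bigg(\prod_{i=1}^3\frac{d_i}{d_i+1}\Bigg)\left[8-\sum_{x'|y'}\frac{\min(d_{abx'},d_{cy'})-1}{\min(d_{abx'},d_{cy'})}\right],$$ the sum running over all eight ordered bipartitions $x'|y'$ of $\{1',2',3'\}$ (including $x'=\emptyset$ and $y'=\emptyset$), with $d_{abx'}=d_ad_b\prod_{i'\in x'}d_i$ and $d_{cy'}=d_c\prod_{i'\in y'}d_i$.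
   Context: For a pure state $|\psi\rangle\in\mathcal{H}$ and a bipartition $g|g'$ of $\{1,2,3\}$, $\tau_{g|g'}(|\psi\rangle)=2\big(1-\operatorname{tr}[(\operatorname{tr}_g|\psi\rangle\langle\psi|)^2]\big)$; the one-tangle is $\tau_1=\frac13(\tau_{12|3}+\tau_{13|2}+\tau_{23|1})$. For a unitary $U$ on $\mathcal{H}$, $\epsilon_{ab|c}(U)$ (resp. $\epsilon_1(U)$) is the average of $\tau_{ab|c}(U|\psi_{\rm sep}\rangle)$ (resp. $\tau_1(U|\psi_{\rm sep}\rangle)$) over $|\psi_{\rm sep}\rangle=|\psi_1\rangle\otimes|\psi_2\rangle\otimes|\psi_3\rangle$, each $|\psi_i\rangle$ drawn independently from the unitarily invariant measure on pure states of $\mathcal{H}_i$. The primed labels $1',2',3'$ refer to a copy $\mathcal{H}'=\mathcal{H}_{1'}\otimes\mathcal{H}_{2'}\otimes\mathcal{H}_{3'}$ of $\mathcal{H}$ with $\dim\mathcal{H}_{i'}=d_i$. *)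

(* Defs.v *)
From mathcomp Require Import all_boot all_order all_algebra.
From mathcomp Require Import spectral complex.
From mathcomp Require Import all_classical all_reals all_analysis.
Set Implicit Arguments. Unset Strict Implicit. Unset Printing Implicit Defensive.
Import Order.TTheory GRing.Theory Num.Theory.
Local Open Scope classical_set_scope.
Local Open Scope ring_scope.

(* Kronecker (tensor) product of column vectors:
   (kronv a b) (mxvec_index i j) = a i * b j. *)
Definition kronv (C : nzRingType) (m n : nat) (a : 'cV[C]_m) (b : 'cV[C]_n)
  : 'cV[C]_(m * n) := (mxvec (a *m b^T))^T.

(* Index of basis vector |i1 i2 i3> in H = H1 (x) H2 (x) H3 = C^(d1*d2*d3),
   consistent with kronv (kronv . .) . *)
Definition idx3 (d1 d2 d3 : nat) (i1 : 'I_d1) (i2 : 'I_d2) (i3 : 'I_d3)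
  : 'I_(d1 * d2 * d3) := mxvec_index (mxvec_index i1 i2) i3.

Definition psep (C : nzRingType) (d1 d2 d3 : nat)
  (p1 : 'cV[C]_d1) (p2 : 'cV[C]_d2) (p3 : 'cV[C]_d3) : 'cV[C]_(d1 * d2 * d3) :=
  kronv (kronv p1 p2) p3.

Section Tangles.
Variables (R : realType) (d1 d2 d3 : nat).
Local Notation C := (R[i]).
Implicit Types phi : 'cV[C]_(d1 * d2 * d3).

(* Reduced density matrices of |phi><phi| : tr_{12}, tr_{13}, tr_{23}. *)
Definition rho3 phi : 'M[C]_d3 := \matrix_(k, l)
  \sum_(i1 < d1) \sum_(i2 < d2) phi (idx3 i1 i2 k) 0 * (phi (idx3 i1 i2 l) 0)^*.
Definition rho2 phi : 'M[C]_d2 := \matrix_(k, l)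
  \sum_(i1 < d1) \sum_(i3 < d3) phi (idx3 i1 k i3) 0 * (phi (idx3 i1 l i3) 0)^*.
Definition rho1 phi : 'M[C]_d1 := \matrix_(k, l)
  \sum_(i2 < d2) \sum_(i3 < d3) phi (idx3 k i2 i3) 0 * (phi (idx3 l i2 i3) 0)^*.

Definition tau12_3 phi : R := 2 * (1 - complex.Re (\tr (rho3 phi *m rho3 phi))).
Definition tau13_2 phi : R := 2 * (1 - complex.Re (\tr (rho2 phi *m rho2 phi))).
Definition tau23_1 phi : R := 2 * (1 - complex.Re (\tr (rho1 phi *m rho1 phi))).

Definition tau1 phi : R := (tau12_3 phi + tau13_2 phi + tau23_1 phi) / 3.

(* The bound tilde-epsilon_{ab|c}, given dab = d_a d_b and dc = d_c:
   sum over all 8 subsets x' of {1',2',3'} (y' = complement). *)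
Definition dimv (i : 'I_3) : nat := nth 0%N [:: d1; d2; d3] i.
Definition prodd (S : {set 'I_3}) : nat := (\prod_(i in S) dimv i)%N.
Definition eps_tilde (dab dc : nat) : R :=
  2 - 2 * (\prod_(i < 3) ((dimv i)%:R / (dimv i).+1%:R))
        * (8 - \sum_(x : {set 'I_3})
                 ((minn (dab * prodd x) (dc * prodd (~: x)))%:R - 1)
                 / (minn (dab * prodd x) (dc * prodd (~: x)))%:R).
Definition eps_tilde12_3 : R := eps_tilde (d1 * d2) d3.
Definition eps_tilde13_2 : R := eps_tilde (d1 * d3) d2.
Definition eps_tilde23_1 : R := eps_tilde (d2 * d3) d1.
Definition eps_tilde1 : R := (eps_tilde12_3 + eps_tilde13_2 + eps_tilde23_1) / 3.

End Tangles.

(* A random pure state psi : T -> C^d on the probability space (T, P) distributed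
   according to the unitarily invariant measure: psi is a unit vector,
   its coordinates are measurable, and the law of psi is invariant under
   every unitary V (P(psi in A) = P(V psi in A) for every A whose preimages are
   events).  By uniqueness of the unitarily invariant probability measure on the
   unit sphere, this pins down the law of psi. *)
Definition haar_random_state (R : realType) (dT : measure_display)
  (T : measurableType dT) (P : probability T R) (d : nat)
  (psi : T -> 'cV[R[i]]_d) : Prop :=
  [/\ (forall t, \sum_(k < d) (psi t k 0)^* * psi t k 0 = 1),
      (forall k : 'I_d, measurable_fun setT (fun t => complex.Re (psi t k 0))),
      (forall k : 'I_d, measurable_fun setT (fun t => complex.Im (psi t k 0))) &
      (forall V : 'M[R[i]]_d, V \is unitarymx ->
        forall A : set 'cV[R[i]]_d,
          measurable (psi @^-1` A) ->
          measurable ((fun t => V *m psi t) @^-1` A) ->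
          P (psi @^-1` A) = P ((fun t => V *m psi t) @^-1` A))].

(* Main.v *)
Require Import Defs.
From mathcomp Require Import all_boot all_order all_algebra.
From mathcomp Require Import spectral complex.
From mathcomp Require Import all_classical all_reals all_analysis.
From mathcomp Require Import measurable_realfun ring lra zify.
Import Order.TTheory GRing.Theory Num.Theory.
Local Open Scope ring_scope.
Set Implicit Arguments. Unset Strict Implicit. Unset Printing Implicit Defensive.

(** The purity of a reduced state of [phi] is the quartic form
    [sum_(b,b') |sum_a phi(a,b) conj(phi(a,b'))|^2].  Averaging it over one Haar
    random tensor factor of [psi_sep] replaces [psi_i psi_j conj(psi_k psi_l)] by
    [(delta_ik delta_jl + delta_il delta_jk) / (d (d + 1))], which turns the form
    into the sum of two quartic forms, where the index of that factor joins
    either side of the cut.  After three averages there are eight terms, one for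
    each bipartition of the input indices: the purities of the (unnormalized)
    Choi state of [U].  By Cauchy-Schwarz each of them is at least
    [(sum |U_mn|^2)^2 = (d1 d2 d3)^2] divided by the smaller of the dimensions of
    the two sides. *)

(** * Quartic forms *)

(** The purity of the [B]-marginal of the possibly unnormalized vector with amplitudes [f]. The
    squared modulus is kept as a product of conjugate sums so that it expands multilinearly. *)
Definition quartic {C : numClosedFieldType} {A B : finType} (f : A -> B -> C) : C :=
  \sum_b \sum_b' (\sum_a f a b * (f a b')^*) * (\sum_a (f a b)^* * f a b').

Section Quartic.
Variable C : numClosedFieldType.

(** Both sides regroup the same fourfold sum over [a], [a'], [b], [b']: the two marginals of a pure
    vector have equal purity. *)
Lemma quartic_tr (A B : finType) (f : A -> B -> C) :
  quartic f =
  \sum_a \sum_a' (\sum_b f a b * (f a' b)^*) * (\sum_b (f a b)^* * f a' b).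
Proof.
transitivity (\sum_b \sum_b' \sum_a \sum_a'
    f a b * (f a b')^* * ((f a' b)^* * f a' b')).
  apply: eq_bigr => b _; apply: eq_bigr => b' _.
  rewrite mulr_suml; apply: eq_bigr => a _.
  by rewrite mulr_sumr.
transitivity (\sum_a \sum_a' \sum_b \sum_b'
    f a b * (f a' b)^* * ((f a b')^* * f a' b')).
  under eq_bigr do rewrite exchange_big /=.
  rewrite exchange_big /=; apply: eq_bigr => a _.
  under eq_bigr do rewrite exchange_big /=.
  rewrite exchange_big /=; apply: eq_bigr => a' _.
  by apply: eq_bigr => b _; apply: eq_bigr => b' _; ring.
apply: eq_bigr => a _; apply: eq_bigr => a' _.
rewrite mulr_suml; apply: eq_bigr => b _.
by rewrite mulr_sumr.
Qed.

Lemma quarticE (A B : finType) (f : A -> B -> C) :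
  quartic f = \sum_b \sum_b' `|\sum_a f a b * (f a b')^*| ^+ 2.
Proof.
apply: eq_bigr => b _; apply: eq_bigr => b' _; rewrite normCK; congr (_ * _).
by rewrite rmorph_sum; apply: eq_bigr => a _; rewrite rmorphM /= conjCK.
Qed.

Lemma quartic_ge0 (A B : finType) (f : A -> B -> C) : 0 <= quartic f.
Proof.
by rewrite quarticE; apply: sumr_ge0 => b _; apply: sumr_ge0 => b' _; apply: exprn_ge0.
Qed.

Lemma eq_quartic (A B : finType) (f g : A -> B -> C) :
  f =2 g -> quartic f = quartic g.
Proof.
move=> fg; apply: eq_bigr => b _; apply: eq_bigr => b' _.
by congr (_ * _); apply: eq_bigr => a _; rewrite !fg.
Qed.

Lemma quartic_swap (A B : finType) (f : A -> B -> C) :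
  quartic (fun b a => f a b) = quartic f.
Proof. by rewrite [RHS]quartic_tr. Qed.

Lemma sqr_sum_le_card (I : finType) (x : I -> C) :
  (forall i, 0 <= x i) -> (\sum_i x i) ^+ 2 <= #|I|%:R * \sum_i x i ^+ 2.
Proof.
move=> x0; have xr i : x i \is Num.real by apply: ger0_real.
(* Lagrange's identity: twice the Cauchy-Schwarz defect against the constant vector is a sum of
   squared differences over ordered pairs. *)
rewrite -subr_ge0 -(pmulr_rge0 _ (ltr0n C 2)).
suff -> : 2 * (#|I|%:R * \sum_i x i ^+ 2 - (\sum_i x i) ^+ 2) =
    \sum_i \sum_j (x i - x j) ^+ 2.
  apply: sumr_ge0 => i _; apply: sumr_ge0 => j _.
  by rewrite real_exprn_even_ge0 // rpredB.
have -> : \sum_i \sum_j (x i - x j) ^+ 2 =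
   \sum_i (x i ^+ 2 * #|I|%:R - 2 * x i * (\sum_j x j) + \sum_j x j ^+ 2).
  apply: eq_bigr => i _; rewrite mulr_sumr mulr_natr -(sumr_const I).
  rewrite -sumrB -big_split /=.
  by apply: eq_bigr => j _; ring.
rewrite big_split sumrB /= sumr_const -!mulr_suml -mulr_sumr.
by rewrite -[_ *+ #|_|]mulr_natl; ring.
Qed.

(** Cauchy-Schwarz over [b] applied to the marginal weights; their squares are the diagonal terms
    [b' = b] of the form, and the other terms are nonnegative. *)
Lemma quartic_ge_card (A B : finType) (f : A -> B -> C) :
  (\sum_a \sum_b `|f a b| ^+ 2) ^+ 2 <= #|B|%:R * quartic f.
Proof.
rewrite exchange_big /=.
apply: le_trans (sqr_sum_le_card _) _.
  by move=> b; apply: sumr_ge0 => a _; apply: exprn_ge0.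
rewrite ler_wpM2l ?ler0n // quarticE; apply: ler_sum => b _.
rewrite (bigD1 b) //= -[leLHS]addr0 lerD //; last first.
  by apply: sumr_ge0 => b' _; apply: exprn_ge0.
have -> : \sum_a f a b * (f a b)^* = \sum_a `|f a b| ^+ 2.
  by apply: eq_bigr => a _; rewrite normCK.
by rewrite ger0_norm //; apply: sumr_ge0 => a _; apply: exprn_ge0.
Qed.

Lemma quartic_ge_minn (A B : finType) (f : A -> B -> C) :
  (\sum_a \sum_b `|f a b| ^+ 2) ^+ 2 <= (minn #|A| #|B|)%:R * quartic f.
Proof.
case: (leqP #|A| #|B|) => _; last exact: quartic_ge_card.
by rewrite exchange_big -quartic_swap /=; apply: quartic_ge_card.
Qed.

End Quartic.

(** * Complex-valued expectation *)

Section ComplexExpectation.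
Context {R : realType} {dT : measure_display} {T : measurableType dT}.
Local Notation C := R[i].
Implicit Types f g : T -> C.

(** A class closed under sums, products and conjugation whose members are integrable for every
    probability measure, so it covers all polynomials in the coordinates of random states. *)
Definition bounded_measurable f : Prop :=
  [/\ measurable_fun setT (fun t => complex.Re (f t)),
      measurable_fun setT (fun t => complex.Im (f t)) &
      exists M : R, forall t, `|complex.Re (f t)| <= M /\ `|complex.Im (f t)| <= M].

Lemma complexReD (z w : C) : complex.Re (z + w) = complex.Re z + complex.Re w.
Proof. by case: z; case: w. Qed.
Lemma complexImD (z w : C) : complex.Im (z + w) = complex.Im z + complex.Im w.
Proof. by case: z; case: w. Qed.
Lemma complexReM (z w : C) :
  complex.Re (z * w) = complex.Re z * complex.Re w - complex.Im z * complex.Im w.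
Proof. by case: z; case: w. Qed.
Lemma complexImM (z w : C) :
  complex.Im (z * w) = complex.Re z * complex.Im w + complex.Im z * complex.Re w.
Proof. by case: z; case: w. Qed.
Lemma complexRe_conj (z : C) : complex.Re z^* = complex.Re z.
Proof. by case: z. Qed.
Lemma complexIm_conj (z : C) : complex.Im z^* = - complex.Im z.
Proof. by case: z. Qed.

Lemma bounded_measurable_cst (c : C) : bounded_measurable (fun=> c).
Proof.
split; [exact: measurable_cst|exact: measurable_cst|].
exists (Num.max `|complex.Re c| `|complex.Im c|) => t.
by rewrite !le_max !lexx orbT.
Qed.

Lemma bounded_measurableD f g : bounded_measurable f -> bounded_measurable g ->
  bounded_measurable (fun t => f t + g t).
Proof.
move=> [mRf mIf [M hM]] [mRg mIg [N hN]]; split.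
- under eq_fun do rewrite complexReD; exact: measurable_funD.
- under eq_fun do rewrite complexImD; exact: measurable_funD.
exists (M + N) => t; have [h1 h2] := hM t; have [h3 h4] := hN t.
by rewrite complexReD complexImD; split; apply: le_trans (ler_normD _ _) _; apply: lerD.
Qed.

Lemma bounded_measurableM f g : bounded_measurable f -> bounded_measurable g ->
  bounded_measurable (fun t => f t * g t).
Proof.
move=> [mRf mIf [M hM]] [mRg mIg [N hN]]; split.
- under eq_fun do rewrite complexReM; apply: measurable_funB; exact: measurable_funM.
- under eq_fun do rewrite complexImM; apply: measurable_funD; exact: measurable_funM.
exists (M * N + M * N) => t; have [h1 h2] := hM t; have [h3 h4] := hN t.
rewrite complexReM complexImM; split.
  by apply: le_trans (ler_normB _ _) _; rewrite !normrM lerD // ler_pM.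
by apply: le_trans (ler_normD _ _) _; rewrite !normrM lerD // ler_pM.
Qed.

Lemma bounded_measurable_conj f :
  bounded_measurable f -> bounded_measurable (fun t => (f t)^*).
Proof.
move=> [mR mI [M hM]]; split.
- by under eq_fun do rewrite complexRe_conj.
- under eq_fun do rewrite complexIm_conj; exact: measurableT_comp.
by exists M => t; rewrite complexRe_conj complexIm_conj normrN.
Qed.

Lemma bounded_measurable_sum (I : Type) (r : seq I) (P : pred I) (F : I -> T -> C) :
  (forall i, bounded_measurable (F i)) ->
  bounded_measurable (fun t => \sum_(i <- r | P i) F i t).
Proof.
move=> hF; elim: r => [|i r IH].
  by under eq_fun do rewrite big_nil; exact: bounded_measurable_cst.
under eq_fun do rewrite big_cons; case: (P i) => //.
exact: bounded_measurableD.
Qed.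

Variable P : probability T R.

Definition cexpect f : C :=
  Complex (Rintegral P setT (fun t => complex.Re (f t)))
          (Rintegral P setT (fun t => complex.Im (f t))).

Lemma bounded_integrable (f : T -> R) (M : R) : measurable_fun setT f ->
  (forall t, `|f t| <= M) -> P.-integrable setT (EFin \o f).
Proof.
move=> mf fM; apply: measurable_bounded_integrable => //.
  exact: le_lt_trans (probability_le1 P measurableT) (ltry 1).
exists M; split; first by rewrite num_real.
by move=> N MN t _ /=; apply: le_trans (fM t) (ltW MN).
Qed.

Lemma integrable_Re f : bounded_measurable f ->
  P.-integrable setT (EFin \o (fun t => complex.Re (f t))).
Proof. by move=> [mR _ [M hM]]; apply: (@bounded_integrable _ M) => // t; have [] := hM t. Qed.

Lemma integrable_Im f : bounded_measurable f ->
  P.-integrable setT (EFin \o (fun t => complex.Im (f t))).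
Proof. by move=> [_ mI [M hM]]; apply: (@bounded_integrable _ M) => // t; have [] := hM t. Qed.

Lemma cexpect_cst c : cexpect (fun=> c) = c.
Proof.
by rewrite /cexpect !Rintegral_cst //= probability_setT /= !mulr1; case: c.
Qed.

Lemma cexpectD f g : bounded_measurable f -> bounded_measurable g ->
  cexpect (fun t => f t + g t) = cexpect f + cexpect g.
Proof.
move=> hf hg; rewrite /cexpect; under eq_Rintegral do rewrite complexReD.
under [X in Complex _ X]eq_Rintegral do rewrite complexImD.
rewrite !RintegralD //; [exact: integrable_Im|exact: integrable_Im|
  exact: integrable_Re|exact: integrable_Re].
Qed.

Lemma cexpectZ c f : bounded_measurable f ->
  cexpect (fun t => c * f t) = c * cexpect f.
Proof.
move=> hf; have hR := integrable_Re hf; have hI := integrable_Im hf.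
case: c => a b; rewrite /cexpect; under eq_Rintegral do rewrite complexReM /=.
under [X in Complex _ X]eq_Rintegral do rewrite complexImM /=.
have Z r h : P.-integrable setT (EFin \o h) ->
    P.-integrable setT (EFin \o (fun t => r * h t)).
  move=> hh; have -> : EFin \o (fun t => r * h t) = (fun t => r%:E * (EFin \o h) t)%E.
    by apply/funext => t.
  exact: integrableZl.
rewrite RintegralB ?RintegralD ?RintegralZl //; exact: Z.
Qed.

Lemma cexpect_sum (I : Type) (r : seq I) (Q : pred I) (F : I -> T -> C) :
  (forall i, bounded_measurable (F i)) ->
  cexpect (fun t => \sum_(i <- r | Q i) F i t) = \sum_(i <- r | Q i) cexpect (F i).
Proof.
move=> hF; elim: r => [|i r IH].
  under [in LHS]eq_fun do rewrite big_nil; by rewrite big_nil cexpect_cst.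
rewrite big_cons; under [in LHS]eq_fun do rewrite big_cons.
case: (Q i) => //; rewrite cexpectD ?IH //; exact: bounded_measurable_sum.
Qed.

End ComplexExpectation.

(** * Unitary invariance of expectations *)

Section HaarInvariance.
Context {R : realType} {dT : measure_display} {T : measurableType dT}.
Variables (P : probability T R) (d : nat) (psi : T -> 'cV[R[i]]_d).
Hypothesis h : haar_random_state P psi.

Lemma haar_Rintegral_invariant (V : 'M[R[i]]_d) (g : 'cV[R[i]]_d -> R) :
  V \is unitarymx ->
  P.-integrable setT (EFin \o (fun t => g (psi t))) ->
  P.-integrable setT (EFin \o (fun t => g (V *m psi t))) ->
  Rintegral P setT (fun t => g (V *m psi t)) = Rintegral P setT (fun t => g (psi t)).
Proof.
move=> hV i1 i2; have [_ _ _ inv] := h.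
have m1 : measurable_fun setT (fun t => g (psi t)).
  by apply/measurable_EFinP; exact: measurable_int i1.
have m2 : measurable_fun setT (fun t => g (V *m psi t)).
  by apply/measurable_EFinP; exact: measurable_int i2.
have E (f : T -> R) (mf : measurable_fun setT f) : P.-integrable setT (EFin \o f) ->
    (\int[P]_t (f t)%:E = \int[pushforward P f]_y y%:E)%E.
  move=> fi; rewrite integral_pushforward //; exact: measurable_EFin.
rewrite /Rintegral (E _ m1 i1) (E _ m2 i2); congr fine.
(* The laws of [g (psi t)] and [g (V *m psi t)] on the real line agree: the invariance of sets is
   applied to the preimage of [A] under [g], whose two pullbacks to [T] are measurable. *)
apply: eq_measure_integral => A mA _ /=; rewrite /pushforward.
apply/esym/(inv V hV (g @^-1` A)%classic).
  by rewrite -[X in measurable X]setTI; exact: m1.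
by rewrite -[X in measurable X]setTI; exact: m2.
Qed.

Lemma haar_cexpect_invariant (V : 'M[R[i]]_d) (g : 'cV[R[i]]_d -> R[i]) :
  V \is unitarymx ->
  bounded_measurable (fun t => g (psi t)) ->
  bounded_measurable (fun t => g (V *m psi t)) ->
  cexpect P (fun t => g (V *m psi t)) = cexpect P (fun t => g (psi t)).
Proof.
move=> hV b1 b2; rewrite /cexpect; congr Complex.
  apply: (@haar_Rintegral_invariant V (fun v => complex.Re (g v))) => //; exact: integrable_Re.
apply: (@haar_Rintegral_invariant V (fun v => complex.Im (g v))) => //; exact: integrable_Im.
Qed.

End HaarInvariance.

(** * Fourth moments of Haar random states *)

Lemma diag_unitarymx (C : numClosedFieldType) (n : nat) (w : 'rV[C]_n) :
  (forall i, w 0 i * (w 0 i)^* = 1) -> diag_mx w \is unitarymx.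
Proof.
move=> hw; apply/unitarymxP/matrixP => i j.
rewrite mul_diag_mx !mxE eq_sym; case: eqVneq => [->|_]; first by rewrite mulr1n hw.
by rewrite mulr0n conjC0 mulr0.
Qed.

(** The Householder reflection in the hyperplane orthogonal to [u], with [s] the squared norm of
    [u]: it is self-adjoint and an involution. *)
Lemma reflection_unitarymx (C : numClosedFieldType) (n : nat) (u : 'cV[C]_n) (s : C) :
  s != 0 -> s^* = s -> u^t*%sesqui *m u = s%:M ->
  1%:M - (2 / s) *: (u *m u^t*%sesqui) \is unitarymx.
Proof.
move=> s0 sr hu; apply/unitarymxP.
set V := 1%:M - _.
have -> : V^t*%sesqui = V.
  apply/matrixP => i j; rewrite !mxE rmorphB /= rmorphM /= fmorph_div /= sr.
  rewrite rmorph_sum !big_ord1 !mxE !rmorphM /= !conjCK !rmorph_nat eq_sym; ring.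
rewrite /V mulmxBl mul1mx mulmxBr mulmx1 -scalemxAl -!scalemxAr.
have -> : u *m u^t*%sesqui *m (u *m u^t*%sesqui) = s *: (u *m u^t*%sesqui).
  by rewrite mulmxA -(mulmxA u) hu mul_mx_scalar scalemxAl.
rewrite !scalerA (_ : 2 / s * (2 / s) * s = 2 / s + 2 / s); last by field.
by rewrite scalerDl; set x := _ *: _; rewrite opprB addrK subrK.
Qed.

Section HaarMoments.
Context {R : realType} {dT : measure_display} {T : measurableType dT}.
Variables (P : probability T R) (d : nat) (psi : T -> 'cV[R[i]]_d).
Hypothesis h : haar_random_state P psi.

Lemma haar_sum_sqr t : \sum_k psi t k 0 * (psi t k 0)^* = 1.
Proof. by have [h1 _ _ _] := h; rewrite -(h1 t); apply: eq_bigr => k _; rewrite mulrC. Qed.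

Lemma haar_coord_bounded k : bounded_measurable (fun t => psi t k 0).
Proof.
have [h1 mR mI _] := h; split => //; exists 1 => t.
have : \sum_k (complex.Re (psi t k 0) ^+ 2 + complex.Im (psi t k 0) ^+ 2) = 1.
  transitivity (complex.Re (1 : R[i])) => //; rewrite -(haar_sum_sqr t).
  rewrite (big_morph _ (@complexReD R) (erefl _)); apply: eq_bigr => i _.
  by rewrite complexReM complexRe_conj complexIm_conj; ring.
rewrite (bigD1 k) //= => e.
have : 0 <= \sum_(i < d | i != k)
    (complex.Re (psi t i 0) ^+ 2 + complex.Im (psi t i 0) ^+ 2).
  by apply: sumr_ge0 => i _; rewrite addr_ge0 ?sqr_ge0.
move: e (sqr_ge0 (complex.Re (psi t k 0))) (sqr_ge0 (complex.Im (psi t k 0))).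
set x := complex.Re _; set y := complex.Im _; set S := \sum_(_ < _ | _) _ => e x0 y0 S0.
by split; rewrite -(ler_pXn2r (n := 2)) ?nnegrE // expr1n real_normK ?num_real //; lra.
Qed.

Definition haar_moment (i j k l : 'I_d) : R[i] :=
  cexpect P (fun t => psi t i 0 * psi t j 0 * (psi t k 0)^* * (psi t l 0)^*).

Lemma haar_monomial_bounded i j k l : bounded_measurable
  (fun t => psi t i 0 * psi t j 0 * (psi t k 0)^* * (psi t l 0)^*).
Proof.
do 3 ?apply: bounded_measurableM; try apply: bounded_measurable_conj;
exact: haar_coord_bounded.
Qed.

(** Invariance under the diagonal unitary with entries [w], which only rescales the monomial. *)
Lemma haar_moment_phase (w : 'I_d -> R[i]) i j k l :
  (forall i, w i * (w i)^* = 1) ->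
  haar_moment i j k l = w i * w j * (w k)^* * (w l)^* * haar_moment i j k l.
Proof.
move=> hw; set V := diag_mx (\row_i w i).
have hV : V \is unitarymx by apply: diag_unitarymx => m; rewrite mxE.
have VE t m : (V *m psi t) m 0 = w m * psi t m 0 by rewrite mul_diag_mx !mxE.
pose g (v : 'cV[R[i]]_d) := v i 0 * v j 0 * (v k 0)^* * (v l 0)^*.
have gE : (fun t => g (V *m psi t)) = (fun t => w i * w j * (w k)^* * (w l)^* *
    (psi t i 0 * psi t j 0 * (psi t k 0)^* * (psi t l 0)^*)).
  by apply/funext => t; rewrite /g !VE !rmorphM /=; ring.
have hb := haar_monomial_bounded i j k l.
rewrite /haar_moment -cexpectZ // -gE (haar_cexpect_invariant h hV) // gE.
apply: bounded_measurableM => //; exact: bounded_measurable_cst.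
Qed.

Lemma haar_moment_eq0 i j k l :
  ~~ ((i == k) && (j == l) || (i == l) && (j == k)) -> haar_moment i j k l = 0.
Proof.
move=> nn.
(* The total phase is ['i] to the power of the multiplicity of [m] among [i], [j] minus that among
   [k], [l]. This exponent lies between -2 and 2, so the phase is 1 only if it is 0; a sign -1 in
   place of ['i] would miss the exponents 2 and -2. *)
pose w m (n : 'I_d) : R[i] := if n == m then 'i else 1.
have hw m n : w m n * (w m n)^* = 1.
  by rewrite /w; case: ifP => _; rewrite -normCK ?normCi ?normr1 expr1n.
suff [m hm] : exists m, w m i * w m j * (w m k)^* * (w m l)^* != 1.
  have := haar_moment_phase i j k l (hw m).
  move/eqP; rewrite -subr_eq0 -{1}[haar_moment _ _ _ _]mul1r -mulrBl mulf_eq0.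
  by rewrite subr_eq0 eq_sym (negbTE hm) => /eqP.
have i2 : 'i * 'i = -1 :> R[i] by rewrite -expr2 sqrCi.
have n1 : -1 != 1 :> R[i] by rewrite -subr_eq0 -opprD oppr_eq0 -mulr2n pnatr_eq0.
have ni : 'i != 1 :> R[i].
  by apply: contra_neq n1 => e; rewrite -i2 e mulr1.
have nNi : - 'i != 1 :> R[i].
  by apply: contra_neq n1 => e; rewrite -i2 -[LHS]mulrNN e mulr1.
have wE m n : (w m n)^* = if n == m then - 'i else 1.
  by rewrite /w; case: ifP => _; rewrite ?conjC1 ?conjCi.
move: nn; rewrite ![_ == k]eq_sym ![_ == l]eq_sym.
have [->|ij] := eqVneq i j.
  rewrite andbC orbb => nn; exists j; move: nn; rewrite !wE /w eqxx i2.
  by case: (k == j); case: (l == j) => //= _; rewrite ?mulr1 ?mulN1r ?opprK.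
have ji : j != i by rewrite eq_sym.
have [->|ki] := eqVneq k i; have [->|li] := eqVneq l i => /=.
- move=> _; exists i; rewrite !wE /w eqxx (negbTE ji) mulr1.
  by rewrite -mulrA mulrNN i2 mulrN1.
- rewrite orbF => lj; exists j; rewrite !wE /w eqxx (negbTE ij) (negbTE lj).
  by rewrite !mulr1 mul1r.
- move=> kj; exists j; rewrite !wE /w eqxx (negbTE ij) (negbTE kj).
  by rewrite !mulr1 mul1r.
by move=> _; exists i; rewrite !wE /w eqxx (negbTE ji) (negbTE ki) (negbTE li) !mulr1.
Qed.

Lemma haar_moment_swapl i j k l : haar_moment i j k l = haar_moment j i k l.
Proof. by rewrite /haar_moment; congr cexpect; apply/funext => t; ring. Qed.

(* The reflection [V] of the proof acts on the coordinates [i], [j] by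
   [(x, y) |-> ((3x + 4y)/5, (4x - 3y)/5)]. *)
Lemma haar_moment_rotate i j : i != j ->
  625 * haar_moment i i i i =
    81 * haar_moment i i i i + 576 * haar_moment i j i j + 256 * haar_moment j j j j
  /\ 625 * haar_moment j j j j =
    256 * haar_moment i i i i + 576 * haar_moment i j i j + 81 * haar_moment j j j j.
Proof.
move=> ij.
(* This normal vector has squared norm 5 and yields the Pythagorean triple 3, 4, 5, so the
   reflection has rational entries and still mixes the two coordinates. *)
pose u : 'cV[R[i]]_d := \col_k ((k == i)%:R - 2 * (k == j)%:R).
have uE (v : 'cV[R[i]]_d) : (u^t*)%sesqui *m v = (v i 0 - 2 * v j 0)%:M.
  apply/matrixP => a b; rewrite !ord1 !mxE eqxx mulr1n.
  under eq_bigr do rewrite !mxE rmorphB rmorphM /= !rmorph_nat mulrBl -mulrA.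
  rewrite sumrB -mulr_sumr (bigD1 i) //= eqxx mul1r big1; last first.
    by move=> k /negbTE ->; rewrite mul0r.
  rewrite (bigD1 j) //= eqxx mul1r big1; last first.
    by move=> k /negbTE ->; rewrite mul0r.
  by rewrite !addr0.
have ji : j != i by rewrite eq_sym.
have uu : (u^t*)%sesqui *m u = 5%:M.
  rewrite uE !mxE !eqxx (negbTE ij) (negbTE ji); congr (_%:M) => /=; ring.
set V := 1%:M - (2 / 5) *: (u *m (u^t*)%sesqui).
have hV : V \is unitarymx.
  by apply: reflection_unitarymx uu; rewrite ?pnatr_eq0 // rmorph_nat.
have VE t k : (V *m psi t) k 0 =
    psi t k 0 - (2 / 5) * u k 0 * (psi t i 0 - 2 * psi t j 0).
  rewrite mulmxBl mul1mx -scalemxAl -mulmxA uE mul_mx_scalar !mxE; ring.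
have Vi t : (V *m psi t) i 0 = (3 * psi t i 0 + 4 * psi t j 0) / 5.
  by rewrite VE mxE eqxx (negbTE ij) /=; field.
have Vj t : (V *m psi t) j 0 = (4 * psi t i 0 - 3 * psi t j 0) / 5.
  by rewrite VE mxE eqxx (negbTE ji) /=; field.
pose M (a b e f : 'I_d) t := psi t a 0 * psi t b 0 * (psi t e 0)^* * (psi t f 0)^*.
have key (k : 'I_d) (a b : R[i]) : a^* = a -> b^* = b ->
    (forall t, (V *m psi t) k 0 = (a * psi t i 0 + b * psi t j 0) / 5) ->
    625 * haar_moment k k k k = a ^+ 4 * haar_moment i i i i +
      4 * a ^+ 2 * b ^+ 2 * haar_moment i j i j + b ^+ 4 * haar_moment j j j j.
  move=> ar br Vk.
  pose g (v : 'cV[R[i]]_d) := v k 0 * v k 0 * (v k 0)^* * (v k 0)^*.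
  (* The nine terms of the square of [a x + b y] times its conjugate. Only the three whose
     unconjugated and conjugated index pairs coincide survive [haar_moment_eq0]. *)
  pose S : seq (R[i] * ('I_d * 'I_d * ('I_d * 'I_d))) :=
   [:: (a ^+ 4, (i, i, (i, i))); (2 * a ^+ 3 * b, (i, i, (i, j)));
       (a ^+ 2 * b ^+ 2, (i, i, (j, j))); (2 * a ^+ 3 * b, (i, j, (i, i)));
       (4 * a ^+ 2 * b ^+ 2, (i, j, (i, j))); (2 * a * b ^+ 3, (i, j, (j, j)));
       (a ^+ 2 * b ^+ 2, (j, j, (i, i))); (2 * a * b ^+ 3, (j, j, (i, j)));
       (b ^+ 4, (j, j, (j, j)))].
  pose F (x : R[i] * ('I_d * 'I_d * ('I_d * 'I_d))) t :=
    x.1 * M x.2.1.1 x.2.1.2 x.2.2.1 x.2.2.2 t.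
  have bF x : bounded_measurable (F x).
    apply: bounded_measurableM; first exact: bounded_measurable_cst.
    exact: haar_monomial_bounded.
  have gE : (fun t => g (V *m psi t)) = (fun t => 625^-1 * \sum_(x <- S) F x t).
    apply/funext => t; rewrite /g Vk fmorph_div rmorphD !rmorphM /= ar br rmorph_nat.
    by rewrite !big_cons big_nil /F /M /=; field.
  have e : haar_moment k k k k = 625^-1 * \sum_(x <- S) cexpect P (F x).
    rewrite -cexpect_sum // -cexpectZ; last exact: bounded_measurable_sum.
    rewrite -gE -[LHS]/(cexpect P (fun t => g (psi t))).
    rewrite -(haar_cexpect_invariant h hV) //; first exact: haar_monomial_bounded.
    rewrite gE; apply: bounded_measurableM; first exact: bounded_measurable_cst.
    exact: bounded_measurable_sum.
  rewrite e mulrA divff ?pnatr_eq0 // mul1r.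
  rewrite !big_cons big_nil /F !cexpectZ /=; try exact: haar_monomial_bounded.
  have ME p q r s : cexpect P (M p q r s) = haar_moment p q r s by [].
  rewrite !ME [haar_moment i i i j]haar_moment_eq0 ?[haar_moment i i j j]haar_moment_eq0
    ?[haar_moment i j i i]haar_moment_eq0 ?[haar_moment i j j j]haar_moment_eq0
    ?[haar_moment j j i i]haar_moment_eq0 ?[haar_moment j j i j]haar_moment_eq0;
    rewrite ?(negbTE ij) ?(negbTE ji) ?andbF //; ring.
split.
  rewrite (key i 3 4) ?rmorph_nat //; ring.
rewrite (key j 4 (-3)) ?rmorphN ?rmorph_nat //; first by ring.
by move=> t; rewrite Vj; ring.
Qed.

(** The square of the normalization condition, averaged. It fixes the one constant that invariance
    leaves free. *)
Lemma haar_moment_total : \sum_p \sum_q haar_moment p q p q = 1.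
Proof.
rewrite -(cexpect_cst P 1).
transitivity (\sum_p cexpect P (fun t =>
   \sum_q psi t p 0 * psi t q 0 * (psi t p 0)^* * (psi t q 0)^*)).
  by apply: eq_bigr => p _; rewrite cexpect_sum // => q; apply: haar_monomial_bounded.
rewrite -cexpect_sum; last first.
  by move=> p; apply: bounded_measurable_sum => q; apply: haar_monomial_bounded.
congr cexpect; apply/funext => t; rewrite -[RHS]mulr1 -{1}(haar_sum_sqr t) -(haar_sum_sqr t).
rewrite mulr_suml; apply: eq_bigr => p _; rewrite mulr_sumr.
by apply: eq_bigr => q _; ring.
Qed.

(** Phases kill the unpaired moments, the reflections make all [haar_moment p p p p] equal to twice
    every mixed moment [c], and normalization gives [c]. *)
Lemma haar_momentE (d0 : (0 < d)%N) i j k l : haar_moment i j k l =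
  (((i == k) && (j == l))%:R + ((i == l) && (j == k))%:R) / (d * d.+1)%:R.
Proof.
pose o : 'I_d := Ordinal d0.
pose c := haar_moment o o o o / 2.
have diag p : haar_moment p p p p = 2 * c.
  rewrite /c mulrC divfK ?pnatr_eq0 //; have [->//|po] := eqVneq p o.
  have [e1 e2] := haar_moment_rotate po.
  (* Subtracting the two reflection identities, where 175 = 256 - 81, leaves 800 = 625 + 175 times
     the difference of the two moments equal to 0. *)
  have e : 625 * haar_moment p p p p - 625 * haar_moment o o o o =
    175 * haar_moment o o o o - 175 * haar_moment p p p p by rewrite e1 e2; ring.
  apply: (@mulfI _ 800); rewrite ?pnatr_eq0 //.
  transitivity (625 * haar_moment p p p p - 625 * haar_moment o o o o +
    175 * haar_moment p p p p + 625 * haar_moment o o o o); first by ring.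
  by rewrite e; ring.
have offdiag p q : p != q -> haar_moment p q p q = c.
  move=> pq; have [e1 _] := haar_moment_rotate pq; apply: (@mulfI _ 576); rewrite ?pnatr_eq0 //.
  (* Here 337 = 81 + 256, and 625 - 337 = 288 is half of 576. *)
  transitivity (625 * haar_moment p p p p - 337 * (2 * c)); last by rewrite diag; ring.
  by rewrite e1 !diag; ring.
have cE : c = (d * d.+1)%:R^-1.
  have D0 : (d * d.+1)%:R != 0 :> R[i] by rewrite pnatr_eq0 muln_eq0 negb_or -lt0n d0.
  apply: (mulIf D0); rewrite mulVf // -[RHS]haar_moment_total.
  transitivity (\sum_(p < d) \sum_(q < d) (c + (p == q)%:R * c)).
    under [RHS]eq_bigr => p _.
      rewrite big_split sumr_const card_ord (bigD1 p) //= eqxx mul1r big1 ?addr0; last first.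
        by move=> q qp; rewrite eq_sym (negbTE qp) mul0r.
      over.
    rewrite sumr_const card_ord -[_ *+ d]mulr_natl -[_ *+ d]mulr_natl mulnS natrD natrM; ring.
  apply: eq_bigr => p _; apply: eq_bigr => q _.
  have [->|pq] := eqVneq p q; first by rewrite diag mul1r; ring.
  by rewrite offdiag // mul0r addr0.
have [/andP[/eqP-> /eqP->]|n1] := boolP ((i == k) && (j == l)).
  rewrite -cE; have [->|kl] := eqVneq k l; first by rewrite diag -natrD.
  by rewrite offdiag // andbF addr0 mul1r.
have [/andP[/eqP il /eqP jk]|n2] := boolP ((i == l) && (j == k)).
  rewrite -cE haar_moment_swapl il jk; have [kl|kl] := eqVneq k l.
    by move: n1; rewrite il jk kl !eqxx.
  by rewrite offdiag // add0r mul1r.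
by rewrite haar_moment_eq0 ?addr0 ?mul0r // negb_or n1.
Qed.

(** Multilinear expansion of the moment formula: each of the two pairings of unconjugated with
    conjugated factors contributes a product of two Hermitian inner products. *)
Lemma haar_wick (d0 : (0 < d)%N) (x y z w : 'I_d -> R[i]) :
  cexpect P (fun t => (\sum_i x i * psi t i 0) * (\sum_j y j * psi t j 0) *
    (\sum_k z k * psi t k 0)^* * (\sum_l w l * psi t l 0)^*) =
  ((\sum_i x i * (z i)^*) * (\sum_j y j * (w j)^*) +
   (\sum_i x i * (w i)^*) * (\sum_j y j * (z j)^*)) / (d * d.+1)%:R.
Proof.
pose F i j k l := x i * y j * (z k)^* * (w l)^*.
transitivity (\sum_i \sum_j \sum_k \sum_l F i j k l * haar_moment i j k l).
  have bm i j k l : bounded_measurable (fun t => F i j k l *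
      (psi t i 0 * psi t j 0 * (psi t k 0)^* * (psi t l 0)^*)).
    apply: bounded_measurableM; first exact: bounded_measurable_cst.
    exact: haar_monomial_bounded.
  have bm1 i j k := bounded_measurable_sum (index_enum 'I_d) predT (bm i j k).
  have bm2 i j := bounded_measurable_sum (index_enum 'I_d) predT (bm1 i j).
  have bm3 i := bounded_measurable_sum (index_enum 'I_d) predT (bm2 i).
  transitivity (cexpect P (fun t => \sum_i \sum_j \sum_k \sum_l F i j k l *
      (psi t i 0 * psi t j 0 * (psi t k 0)^* * (psi t l 0)^*))).
    congr cexpect; apply/funext => t.
    rewrite !mulr_suml; apply: eq_bigr => i _.
    rewrite mulr_sumr !mulr_suml; apply: eq_bigr => j _.
    rewrite rmorph_sum mulr_sumr mulr_suml; apply: eq_bigr => k _.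
    rewrite rmorph_sum mulr_sumr; apply: eq_bigr => l _.
    by rewrite /F !rmorphM /=; ring.
  rewrite cexpect_sum //; apply: eq_bigr => i _.
  rewrite cexpect_sum //; apply: eq_bigr => j _.
  rewrite cexpect_sum //; apply: eq_bigr => k _.
  rewrite cexpect_sum //; apply: eq_bigr => l _.
  rewrite cexpectZ //; exact: haar_monomial_bounded.
have delta (G : 'I_d -> 'I_d -> R[i]) i j :
    \sum_k \sum_l G k l * ((i == k) && (j == l))%:R = G i j.
  rewrite (bigD1 i) //= [X in _ + X]big1 ?addr0; last first.
    move=> k ki; apply: big1 => l _.
    by rewrite eq_sym (negbTE ki) mulr0.
  rewrite (bigD1 j) //= [X in _ + X]big1 ?addr0 ?eqxx ?mulr1 // => l lj.
  by rewrite [j == l]eq_sym (negbTE lj) mulr0.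
transitivity (\sum_i \sum_j (F i j i j + F i j j i) / (d * d.+1)%:R).
  apply: eq_bigr => i _; apply: eq_bigr => j _.
  rewrite -[F i j i j]delta -[F i j j i](delta (fun l k => F i j k l)).
  rewrite [X in _ + X]exchange_big -big_split mulr_suml; apply: eq_bigr => k _.
  rewrite -big_split mulr_suml; apply: eq_bigr => l _ /=.
  by rewrite haar_momentE //; ring.
under eq_bigr do rewrite -mulr_suml; rewrite -mulr_suml; congr (_ / _).
rewrite !mulr_suml -big_split; apply: eq_bigr => i _.
rewrite !mulr_sumr -big_split; apply: eq_bigr => j _.
by rewrite /F /=; ring.
Qed.
End HaarMoments.

(** * Averages of quartic forms *)

Section HaarQuartic.
Context {R : realType} {dT : measure_display} {T : measurableType dT}.
Variables (P : probability T R) (d : nat) (psi : T -> 'cV[R[i]]_d).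
Hypotheses (h : haar_random_state P psi) (d0 : (0 < d)%N).

Lemma haar_quartic (A B : finType) (f : A -> B -> 'I_d -> R[i]) :
  cexpect P (fun t => quartic (fun a b => \sum_i f a b i * psi t i 0)) =
  (quartic (fun (ai : A * 'I_d) b => f ai.1 b ai.2) +
   quartic (fun a (bi : B * 'I_d) => f a bi.1 bi.2)) / (d * d.+1)%:R.
Proof.
pose g a b t := \sum_i f a b i * psi t i 0.
have bg a b : bounded_measurable (g a b).
  apply: bounded_measurable_sum => i; apply: bounded_measurableM.
    exact: bounded_measurable_cst.
  exact: (haar_coord_bounded h).
pose G a a' b b' t := g a b t * g a' b' t * (g a b' t)^* * (g a' b t)^*.
have bG a a' b b' : bounded_measurable (G a a' b b').
  by do 3 ?apply: bounded_measurableM => //; apply: bounded_measurable_conj.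
(* The two pairings of [G]. In [X] the contracted indices [i], [j] accompany [a], [a'], so the
   averaged index joins the [A] side; in [Y] they accompany [b], [b'], so it joins the [B] side. *)
pose X a a' b b' := (\sum_i f a b i * (f a b' i)^*) * (\sum_j (f a' b j)^* * f a' b' j).
pose Y a a' b b' := (\sum_i f a b i * (f a' b i)^*) * (\sum_j (f a b' j)^* * f a' b' j).
transitivity (\sum_b \sum_b' \sum_a \sum_a' (X a a' b b' + Y a a' b b') / (d * d.+1)%:R).
  transitivity (cexpect P (fun t => \sum_b \sum_b' \sum_a \sum_a' G a a' b b' t)).
    congr cexpect; apply/funext => t.
    apply: eq_bigr => b _; apply: eq_bigr => b' _.
    rewrite mulr_suml; apply: eq_bigr => a _.
    by rewrite mulr_sumr; apply: eq_bigr => a' _; rewrite /G /g; ring.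
  rewrite cexpect_sum => [|b]; last by do 3 apply: bounded_measurable_sum => ?.
  apply: eq_bigr => b _.
  rewrite cexpect_sum => [|b']; last by do 2 apply: bounded_measurable_sum => ?.
  apply: eq_bigr => b' _.
  rewrite cexpect_sum => [|a]; last by apply: bounded_measurable_sum => ?.
  apply: eq_bigr => a _.
  rewrite cexpect_sum => [|//]; apply: eq_bigr => a' _.
  rewrite (haar_wick h) //; congr (_ / _); congr (_ * _ + _ * _).
    by apply: eq_bigr => i _; rewrite mulrC.
  by apply: eq_bigr => i _; rewrite mulrC.
rewrite mulrDl [in X in _ = _ + X]quartic_tr.
have -> : quartic (fun (ai : A * 'I_d) b => f ai.1 b ai.2) =
    \sum_b \sum_b' \sum_a \sum_a' X a a' b b'.
  apply: eq_bigr => b _; apply: eq_bigr => b' _.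
  under [RHS]eq_bigr do rewrite -mulr_sumr.
  by rewrite -mulr_suml !pair_bigA.
have -> : \sum_a \sum_a' (\sum_(bi : B * 'I_d) f a bi.1 bi.2 * (f a' bi.1 bi.2)^*) *
      (\sum_(bi : B * 'I_d) (f a bi.1 bi.2)^* * f a' bi.1 bi.2) =
    \sum_b \sum_b' \sum_a \sum_a' Y a a' b b'.
  transitivity (\sum_a \sum_a' \sum_b \sum_b' Y a a' b b').
    apply: eq_bigr => a _; apply: eq_bigr => a' _.
    under [RHS]eq_bigr do rewrite -mulr_sumr.
    by rewrite -mulr_suml !pair_bigA.
  under eq_bigr do rewrite exchange_big /=.
  rewrite exchange_big /=; apply: eq_bigr => b _.
  under eq_bigr do rewrite exchange_big /=.
  by rewrite exchange_big.
rewrite -mulrDl -big_split mulr_suml; apply: eq_bigr => b _.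
rewrite -big_split mulr_suml; apply: eq_bigr => b' _.
rewrite -big_split mulr_suml; apply: eq_bigr => a _.
by rewrite -big_split mulr_suml; apply: eq_bigr.
Qed.

End HaarQuartic.

(** * Expectations over product probability spaces *)

Lemma bounded_measurable_comp {R : realType} {dT dT' : measure_display}
  {T : measurableType dT} {T' : measurableType dT'} (f : T -> R[i]) (g : T' -> T) :
  measurable_fun setT g -> bounded_measurable f ->
  bounded_measurable (fun t => f (g t)).
Proof.
move=> mg [mR mI [M hM]]; split; last by exists M.
- exact: (measurableT_comp mR mg).
exact: (measurableT_comp mI mg).
Qed.

Section Fubini.
Context {R : realType} {e1 e2 : measure_display}.
Context {T1 : measurableType e1} {T2 : measurableType e2}.
Variables (P1 : probability T1 R) (P2 : probability T2 R).

Lemma Rintegral_fubini (f : T1 * T2 -> R) (M : R) : measurable_fun setT f ->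
  (forall t, `|f t| <= M) ->
  Rintegral (P1 \x P2)%E setT f =
  Rintegral P1 setT (fun x => Rintegral P2 setT (fun y => f (x, y))).
Proof.
move=> mf fM.
have i12 : (P1 \x P2)%E.-integrable setT (EFin \o f) := bounded_integrable _ mf fM.
rewrite /Rintegral -(integral12_prod_meas1 i12); congr fine.
apply: eq_integral => x _; rewrite /fubini_F /= fineK //.
apply: integrable_fin_num => //.
apply: (@bounded_integrable _ _ _ P2 (fun y => f (x, y)) M) => //.
exact: measurableT_comp.
Qed.

Lemma cexpect_fubini (f : T1 * T2 -> R[i]) : bounded_measurable f ->
  cexpect (P1 \x P2)%E f = cexpect P1 (fun x => cexpect P2 (fun y => f (x, y))).
Proof.
move=> [mR mI [M hM]]; rewrite /cexpect /=; congr Complex.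
  by apply: (Rintegral_fubini (M := M)) => // t; have [] := hM t.
by apply: (Rintegral_fubini (M := M)) => // t; have [] := hM t.
Qed.

End Fubini.

Lemma bounded_measurable_quartic {R : realType} {dT : measure_display}
  {T : measurableType dT} (A B : finType) (f : T -> A -> B -> R[i]) :
  (forall a b, bounded_measurable (fun t => f t a b)) ->
  bounded_measurable (fun t => quartic (f t)).
Proof.
move=> hf; do 2 apply: bounded_measurable_sum => ?.
by apply: bounded_measurableM; apply: bounded_measurable_sum => ?;
  apply: bounded_measurableM => //; apply: bounded_measurable_conj.
Qed.

Lemma bounded_measurable_lincomb {R : realType} {dT : measure_display}
  {T : measurableType dT} {dT' : measure_display} {T' : measurableType dT'}
  (P : probability T R) (d : nat) (psi : T -> 'cV[R[i]]_d)
  (f : T' -> 'I_d -> R[i]) :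
  haar_random_state P psi ->
  (forall i, bounded_measurable (fun t => f t i)) ->
  bounded_measurable (fun t : T' * T => \sum_i f t.1 i * psi t.2 i 0).
Proof.
move=> h hf; apply: bounded_measurable_sum => i; apply: bounded_measurableM.
  exact: (bounded_measurable_comp (f := f^~ i) measurable_fst).
exact: (bounded_measurable_comp measurable_snd (haar_coord_bounded h i)).
Qed.

(** By Fubini the last factor is averaged first, with [t.1] frozen, so [haar_quartic] applies
    pointwise and one factor is peeled off. *)
Lemma haar_quartic_prod {R : realType} {e e' : measure_display}
  {T : measurableType e} {T' : measurableType e'}
  (P : probability T R) (P' : probability T' R)
  (d : nat) (psi : T -> 'cV[R[i]]_d) (A B : finType)
  (f : T' -> A -> B -> 'I_d -> R[i]) :
  haar_random_state P psi -> (0 < d)%N ->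
  (forall a b i, bounded_measurable (fun t => f t a b i)) ->
  cexpect (P' \x P)%E
    (fun t => quartic (fun a b => \sum_i f t.1 a b i * psi t.2 i 0)) =
  (cexpect P' (fun t => quartic (fun (ai : A * 'I_d) b => f t ai.1 b ai.2)) +
   cexpect P' (fun t => quartic (fun a (bi : B * 'I_d) => f t a bi.1 bi.2)))
   / (d * d.+1)%:R.
Proof.
move=> h d0 hf; rewrite cexpect_fubini; last first.
  apply: bounded_measurable_quartic => a b.
  exact: (bounded_measurable_lincomb (f := fun t => f t a b) h).
have b1 : bounded_measurable (fun t => quartic (fun (ai : A * 'I_d) b => f t ai.1 b ai.2)).
  exact: bounded_measurable_quartic.
have b2 : bounded_measurable (fun t => quartic (fun a (bi : B * 'I_d) => f t a bi.1 bi.2)).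
  exact: bounded_measurable_quartic.
rewrite -cexpectD // mulrC -cexpectZ; last exact: bounded_measurableD.
congr cexpect; apply/funext => t.
exact: etrans (haar_quartic h d0 (f t)) (mulrC _ _).
Qed.

(** A subset is coded by its membership bits, and [d ^ b] is [d] or 1. The third bit is outermost
    because the third factor is averaged first. *)
Lemma sum_bipartitions (V : nmodType) (d1 d2 d3 : nat) (g : nat -> nat -> V) :
  \sum_(x : {set 'I_3}) g (prodd d1 d2 d3 x) (prodd d1 d2 d3 (~: x)) =
  \sum_(b3 : bool) \sum_(b2 : bool) \sum_(b1 : bool)
    g (d3 ^ b3 * d2 ^ b2 * d1 ^ b1)%N (d3 ^ (~~ b3) * d2 ^ (~~ b2) * d1 ^ (~~ b1))%N.
Proof.
pose o0 : 'I_3 := Ordinal (isT : 0 < 3)%N.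
pose o1 : 'I_3 := Ordinal (isT : 1 < 3)%N.
pose o2 : 'I_3 := Ordinal (isT : 2 < 3)%N.
pose S (b : bool * bool * bool) : {set 'I_3} :=
  [set i : 'I_3 | nth false [:: b.2; b.1.2; b.1.1] i].
pose S' (x : {set 'I_3}) := (o2 \in x, o1 \in x, o0 \in x).
have proddE (x : {set 'I_3}) : prodd d1 d2 d3 x =
    (d3 ^ (o2 \in x) * d2 ^ (o1 \in x) * d1 ^ (o0 \in x))%N.
  rewrite /prodd big_mkcond !big_ord_recl big_ord0 /=.
  have -> : ord0 = o0 by apply: val_inj.
  have -> : lift o0 (ord0 : 'I_2) = o1 by apply: val_inj.
  have -> : lift o0 (lift (ord0 : 'I_2) ord0) = o2 by apply: val_inj.
  by rewrite /Defs.dimv; case: (o0 \in x); case: (o1 \in x); case: (o2 \in x) => /=; lia.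
rewrite (reindex S) /=; last first.
  exists S' => [[[b3 b2] b1] _|x _]; first by rewrite /S' !inE.
  by apply/setP => -[[|[|[|//]]] lt3]; rewrite inE /=; congr (_ \in x); apply: val_inj.
rewrite !pair_bigA; apply: eq_bigr => -[[b3 b2] b1] _.
by rewrite !proddE !inE.
Qed.

(** With [sum_pair_right], this shows that the total weight in the Cauchy-Schwarz bound does not
    depend on the side that an index joins. *)
Lemma sum_pair_left (V : nmodType) (A B I : finType) (X : A -> B -> I -> V) :
  \sum_(ai : A * I) \sum_b X ai.1 b ai.2 = \sum_a \sum_b \sum_i X a b i.
Proof.
rewrite -(pair_bigA _ (fun a i => \sum_b X a b i)) /=.
by apply: eq_bigr => a _; rewrite exchange_big.
Qed.

Lemma sum_pair_right (V : nmodType) (A B I : finType) (X : A -> B -> I -> V) :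
  \sum_a \sum_(bi : B * I) X a bi.1 bi.2 = \sum_a \sum_b \sum_i X a b i.
Proof. by apply: eq_bigr => a _; rewrite (pair_bigA _ (X a)). Qed.

(** * Lower bounds for quartic forms averaged over one, two and three factors *)

Section ThreeFactors.
Context {R : realType} {e1 e2 e3 : measure_display}.
Context {T1 : measurableType e1} {T2 : measurableType e2} {T3 : measurableType e3}.
Variables (P1 : probability T1 R) (P2 : probability T2 R) (P3 : probability T3 R).
Variables (d1 d2 d3 : nat).
Variables (psi1 : T1 -> 'cV[R[i]]_d1) (psi2 : T2 -> 'cV[R[i]]_d2)
  (psi3 : T3 -> 'cV[R[i]]_d3).
Hypotheses (h1 : haar_random_state P1 psi1) (h2 : haar_random_state P2 psi2)
  (h3 : haar_random_state P3 psi3).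
Hypotheses (d10 : (0 < d1)%N) (d20 : (0 < d2)%N) (d30 : (0 < d3)%N).
Variables (A B : finType) (F : A -> B -> 'I_d1 -> 'I_d2 -> 'I_d3 -> R[i]).

(** The sums are nested with the third factor outermost, so that each average removes one linear
    layer. [F] will hold the entries of [U]. *)
Definition product_amplitude (t : T1 * T2 * T3) (a : A) (b : B) : R[i] :=
  \sum_i3 (\sum_i2 (\sum_i1 F a b i1 i2 i3 * psi1 t.1.1 i1 0) * psi2 t.1.2 i2 0)
    * psi3 t.2 i3 0.

Lemma bounded_measurable_product_amplitude a b :
  bounded_measurable (fun t => product_amplitude t a b).
Proof.
pose f2 i3 t i2 := \sum_i1 F a b i1 i2 i3 * psi1 t i1 0.
pose f3 (t : T1 * T2) i3 := \sum_i2 f2 i3 t.1 i2 * psi2 t.2 i2 0.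
apply: (bounded_measurable_lincomb (f := f3) h3) => i3.
apply: (bounded_measurable_lincomb (f := f2 i3) h2) => i2.
apply: bounded_measurable_sum => i1; apply: bounded_measurableM.
  exact: bounded_measurable_cst.
exact: haar_coord_bounded h1 _.
Qed.

Local Notation m a b := ((minn a b)%:R^-1 : R[i]).

Lemma quartic_ge (A' B' : finType) (f : A' -> B' -> R[i]) :
  m #|A'| #|B'| * (\sum_a \sum_b `|f a b| ^+ 2) ^+ 2 <= quartic f.
Proof.
(* If one side is empty, the inverse of 0 is 0 and nonnegativity suffices. *)
have [->|m0] := posnP (minn #|A'| #|B'|); first by rewrite invr0 mul0r quartic_ge0.
by rewrite mulrC ler_pdivrMr ?ltr0n // mulrC quartic_ge_minn.
Qed.

(** [haar_quartic] yields two forms, one with [A'] and one with [B'] enlarged by a factor [d1]; each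
    is bounded by [quartic_ge]. The bit [b1] records which side grew. *)
Lemma cexpect_quartic_ge1 (A' B' : finType) (f : A' -> B' -> 'I_d1 -> R[i]) :
  (d1 * d1.+1)%:R^-1 *
  (\sum_(b1 : bool) m (#|A'| * d1 ^ b1) (#|B'| * d1 ^ (~~ b1))) *
  (\sum_a \sum_b \sum_i `|f a b i| ^+ 2) ^+ 2 <=
  cexpect P1 (fun t => quartic (fun a b => \sum_i f a b i * psi1 t i 0)).
Proof.
rewrite (haar_quartic h1) // mulrC mulrCA [leRHS]mulrC ler_wpM2l ?invr_ge0 ?ler0n //.
rewrite big_bool /= !expn1 !expn0 !muln1 mulrDr ![_ ^+ 2 * _]mulrC.
have -> : (#|A'| * d1)%N = #|{: A' * 'I_d1}| by rewrite card_prod card_ord.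
have -> : (#|B'| * d1)%N = #|{: B' * 'I_d1}| by rewrite card_prod card_ord.
apply: lerD; apply: le_trans (quartic_ge _) => /=.
  by rewrite -(sum_pair_left (fun a b i => `|f a b i| ^+ 2)).
by rewrite -(sum_pair_right (fun a b i => `|f a b i| ^+ 2)).
Qed.

(** Averaging [psi2] leaves two forms in [psi1] alone, each bounded by [cexpect_quartic_ge1] on the
    enlarged index type. *)
Lemma cexpect_quartic_ge2 (A' B' : finType) (f : A' -> B' -> 'I_d2 -> 'I_d1 -> R[i]) :
  (d2 * d2.+1)%:R^-1 * (d1 * d1.+1)%:R^-1 *
  (\sum_(b2 : bool) \sum_(b1 : bool)
     m (#|A'| * (d2 ^ b2 * d1 ^ b1)) (#|B'| * (d2 ^ (~~ b2) * d1 ^ (~~ b1)))) *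
  (\sum_a \sum_b \sum_i2 \sum_i1 `|f a b i2 i1| ^+ 2) ^+ 2 <=
  cexpect (P1 \x P2)%E (fun t => quartic (fun a b =>
    \sum_i2 (\sum_i1 f a b i2 i1 * psi1 t.1 i1 0) * psi2 t.2 i2 0)).
Proof.
pose g t a b i2 := \sum_i1 f a b i2 i1 * psi1 t i1 0.
have bg a b i2 : bounded_measurable (fun t => g t a b i2).
  apply: bounded_measurable_sum => i1; apply: bounded_measurableM.
    exact: bounded_measurable_cst.
  exact: haar_coord_bounded h1 _.
rewrite (haar_quartic_prod (f := g) P1 h2) // [leRHS]mulrC -!mulrA.
apply: ler_wpM2l; first by rewrite invr_ge0 ler0n.
rewrite big_bool mulrDl mulrDr; apply: lerD.
  apply: le_trans (cexpect_quartic_ge1 (fun ai b i1 => f ai.1 b ai.2 i1)).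
  rewrite (sum_pair_left (fun a b i2 => \sum_i1 `|f a b i2 i1| ^+ 2)) mulrA.
  by rewrite card_prod card_ord; under eq_bigr do rewrite /= expn1 expn0 mul1n mulnA.
apply: le_trans (cexpect_quartic_ge1 (fun a bi i1 => f a bi.1 bi.2 i1)).
rewrite (sum_pair_right (fun a b i2 => \sum_i1 `|f a b i2 i1| ^+ 2)) mulrA.
by rewrite card_prod card_ord; under eq_bigr do rewrite /= expn1 expn0 mul1n mulnA.
Qed.

Lemma cexpect_quartic_ge3 :
  (d3 * d3.+1)%:R^-1 * (d2 * d2.+1)%:R^-1 * (d1 * d1.+1)%:R^-1 *
  (\sum_(x : {set 'I_3})
     m (#|A| * prodd d1 d2 d3 x) (#|B| * prodd d1 d2 d3 (~: x))) *
  (\sum_a \sum_b \sum_i3 \sum_i2 \sum_i1 `|F a b i1 i2 i3| ^+ 2) ^+ 2 <=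
  cexpect ((P1 \x P2) \x P3)%E (fun t => quartic (product_amplitude t)).
Proof.
rewrite (sum_bipartitions d1 d2 d3 (fun x y => m (#|A| * x) (#|B| * y))).
pose g (t : T1 * T2) a b i3 :=
  \sum_i2 (\sum_i1 F a b i1 i2 i3 * psi1 t.1 i1 0) * psi2 t.2 i2 0.
have bg a b i3 : bounded_measurable (fun t => g t a b i3).
  pose f2 t i2 := \sum_i1 F a b i1 i2 i3 * psi1 t i1 0.
  apply: (bounded_measurable_lincomb (f := f2) h2) => i2.
  apply: bounded_measurable_sum => i1; apply: bounded_measurableM.
    exact: bounded_measurable_cst.
  exact: haar_coord_bounded h1 _.
rewrite (haar_quartic_prod (f := g) (P1 \x P2)%E h3) // [leRHS]mulrC -!mulrA.
apply: ler_wpM2l; first by rewrite invr_ge0 ler0n.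
rewrite big_bool mulrDl !mulrDr; apply: lerD.
  apply: le_trans (cexpect_quartic_ge2 (fun ai b i2 i1 => F ai.1 b i1 i2 ai.2)).
  rewrite (sum_pair_left (fun a b i3 => \sum_i2 \sum_i1 `|F a b i1 i2 i3| ^+ 2)) !mulrA.
  rewrite card_prod card_ord; under eq_bigr do under eq_bigr do
    rewrite /= expn1 expn0 mul1n -[(d3 * _ * _)%N]mulnA mulnA.
  by [].
apply: le_trans (cexpect_quartic_ge2 (fun a bi i2 i1 => F a bi.1 i1 i2 bi.2)).
rewrite (sum_pair_right (fun a b i3 => \sum_i2 \sum_i1 `|F a b i1 i2 i3| ^+ 2)) !mulrA.
rewrite card_prod card_ord; under eq_bigr do under eq_bigr do
    rewrite /= expn1 expn0 mul1n -[(d3 * _ * _)%N]mulnA [(#|B| * _)%N]mulnA.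
by [].
Qed.

End ThreeFactors.

(** * Average one-tangle *)

Lemma sum_mxvec_index (V : nmodType) (m n : nat) (X : 'I_(m * n) -> V) :
  \sum_k X k = \sum_i \sum_j X (mxvec_index i j).
Proof.
by rewrite (reindex _ (curry_mxvec_bij m n)) /= pair_bigA; apply: eq_bigr => -[].
Qed.

Lemma sum_idx3 (V : nmodType) (d1 d2 d3 : nat) (X : 'I_(d1 * d2 * d3) -> V) :
  \sum_n X n = \sum_i3 \sum_i2 \sum_i1 X (idx3 i1 i2 i3).
Proof.
rewrite sum_mxvec_index exchange_big /=; apply: eq_bigr => i3 _.
by rewrite sum_mxvec_index exchange_big.
Qed.

(** This and the next two reindexings, one for each cut, let [Rintegral_tangle_le] treat all cuts
    uniformly. *)
Lemma sum_idx3_12 (V : nmodType) (d1 d2 d3 : nat) (X : 'I_(d1 * d2 * d3) -> V) :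
  \sum_(a : 'I_d1 * 'I_d2) \sum_b X (idx3 a.1 a.2 b) = \sum_n X n.
Proof.
rewrite sum_idx3 exchange_big /=; apply: eq_bigr => i3 _.
by rewrite exchange_big -(pair_bigA _ (fun i1 i2 => X (idx3 i1 i2 i3))).
Qed.

Lemma sum_idx3_13 (V : nmodType) (d1 d2 d3 : nat) (X : 'I_(d1 * d2 * d3) -> V) :
  \sum_(a : 'I_d1 * 'I_d3) \sum_b X (idx3 a.1 b a.2) = \sum_n X n.
Proof.
rewrite sum_idx3 -(pair_bigA _ (fun i1 i3 => \sum_i2 X (idx3 i1 i2 i3))) exchange_big /=.
by apply: eq_bigr => i3 _; rewrite exchange_big.
Qed.

Lemma sum_idx3_23 (V : nmodType) (d1 d2 d3 : nat) (X : 'I_(d1 * d2 * d3) -> V) :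
  \sum_(a : 'I_d2 * 'I_d3) \sum_b X (idx3 b a.1 a.2) = \sum_n X n.
Proof.
by rewrite sum_idx3 -(pair_bigA _ (fun i2 i3 => \sum_i1 X (idx3 i1 i2 i3))) exchange_big.
Qed.

Lemma psep_idx3 (C : comNzRingType) (d1 d2 d3 : nat) (p1 : 'cV[C]_d1)
  (p2 : 'cV[C]_d2) (p3 : 'cV[C]_d3) i1 i2 i3 :
  psep p1 p2 p3 (idx3 i1 i2 i3) 0 = p1 i1 0 * p2 i2 0 * p3 i3 0.
Proof.
rewrite /psep /kronv /idx3 !mxE mxvecE !mxE big_ord1 !mxE.
by rewrite mxvecE !mxE big_ord1 !mxE.
Qed.

(** Each row of [U] is a unit vector. This is the total weight in the Cauchy-Schwarz bound. *)
Lemma unitarymx_sum_sqr (C : numClosedFieldType) (n : nat) (U : 'M[C]_n) :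
  U \is unitarymx -> \sum_i \sum_j `|U i j| ^+ 2 = n%:R.
Proof.
move=> /unitarymxP UU; rewrite -[n in RHS]card_ord -sumr_const.
apply: eq_bigr => i _; transitivity ((1%:M : 'M[C]_n) i i); last by rewrite mxE eqxx.
by rewrite -UU mxE; apply: eq_bigr => j _; rewrite normCK !mxE.
Qed.

(** * Tangles as quartic forms: the traced-out pair indexes [A], the remaining factor [B] *)

Section Purity.
Variables (R : realType) (d1 d2 d3 : nat) (phi : 'cV[R[i]]_(d1 * d2 * d3)).

Lemma tau12_3_quartic : tau12_3 phi = 2 * (1 - complex.Re (quartic
  (fun (a : 'I_d1 * 'I_d2) b => phi (idx3 a.1 a.2 b) 0))).
Proof.
rewrite /tau12_3; congr (_ * (_ - complex.Re _)).
apply: eq_bigr => k _; rewrite mxE; apply: eq_bigr => l _.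
rewrite !mxE !pair_bigA; congr (_ * _).
by apply: eq_bigr => a _; rewrite mulrC.
Qed.

Lemma tau13_2_quartic : tau13_2 phi = 2 * (1 - complex.Re (quartic
  (fun (a : 'I_d1 * 'I_d3) b => phi (idx3 a.1 b a.2) 0))).
Proof.
rewrite /tau13_2; congr (_ * (_ - complex.Re _)).
apply: eq_bigr => k _; rewrite mxE; apply: eq_bigr => l _.
rewrite !mxE !pair_bigA; congr (_ * _).
by apply: eq_bigr => a _; rewrite mulrC.
Qed.

Lemma tau23_1_quartic : tau23_1 phi = 2 * (1 - complex.Re (quartic
  (fun (a : 'I_d2 * 'I_d3) b => phi (idx3 b a.1 a.2) 0))).
Proof.
rewrite /tau23_1; congr (_ * (_ - complex.Re _)).
apply: eq_bigr => k _; rewrite mxE; apply: eq_bigr => l _.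
rewrite !mxE !pair_bigA; congr (_ * _).
by apply: eq_bigr => a _; rewrite mulrC.
Qed.

End Purity.

(** Writing [(M - 1) / M] as [1 - 1 / M], the eight ones cancel the 8; and [d / (d + 1)] is
    [d ^ 2 / (d * (d + 1))], which matches the Haar normalization and the squared weight. *)
Lemma eps_tildeE (R : realType) (d1 d2 d3 dab dc : nat) :
  (0 < d1)%N -> (0 < d2)%N -> (0 < d3)%N -> (0 < dab)%N -> (0 < dc)%N ->
  eps_tilde R d1 d2 d3 dab dc =
  2 * (1 - (d3 * d3.+1)%:R^-1 * (d2 * d2.+1)%:R^-1 * (d1 * d1.+1)%:R^-1 *
    (\sum_(x : {set 'I_3}) (minn (dab * prodd d1 d2 d3 x)
       (dc * prodd d1 d2 d3 (~: x)))%:R^-1) * (d1 * d2 * d3)%:R ^+ 2).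
Proof.
move=> d10 d20 d30 ab0 c0; rewrite /eps_tilde.
have prodd0 x : (0 < prodd d1 d2 d3 x)%N.
  by apply: prodn_gt0 => -[[|[|[|//]]] ?]; rewrite /Defs.dimv.
pose M x := minn (dab * prodd d1 d2 d3 x) (dc * prodd d1 d2 d3 (~: x)).
have M0 x : (M x)%:R != 0 :> R.
  by rewrite pnatr_eq0 -lt0n leq_min !muln_gt0 ab0 c0 !prodd0.
have -> : \sum_(x : {set 'I_3}) ((M x)%:R - 1) / (M x)%:R =
    8 - \sum_x (M x)%:R^-1 :> R.
  transitivity (\sum_(x : {set 'I_3}) (1 - (M x)%:R^-1 : R)).
    by apply: eq_bigr => x _; rewrite mulrBl divff // mul1r.
  rewrite sumrB sumr_const; congr (_ *+ _ - _).
  by rewrite -cardsT -powersetT card_powerset cardsT card_ord.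
rewrite !big_ord_recl big_ord0 /= /Defs.dimv /= mulr1 -/M.
set S := \sum_x _.
have ne (n : nat) : (0 < n)%N -> n%:R != 0 :> R by rewrite pnatr_eq0 lt0n.
have n1 := ne _ d10; have n2 := ne _ d20; have n3 := ne _ d30.
have m1 := ne _ (ltn0Sn d1); have m2 := ne _ (ltn0Sn d2); have m3 := ne _ (ltn0Sn d3).
by rewrite !natrM; field; rewrite n1 n2 n3 !nat1r m1 m2 m3.
Qed.

Lemma RintegralE {R : realType} {e : measure_display} {T : measurableType e}
  (mu : probability T R) (f : T -> R) : mu.-integrable setT (EFin \o f) ->
  (\int[mu]_t (f t)%:E = (Rintegral mu setT f)%:E)%E.
Proof. by move=> fi; rewrite /Rintegral fineK //; apply: integrable_fin_num. Qed.

Lemma Rintegral_tangle {R : realType} {e : measure_display} {T : measurableType e}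
  (mu : probability T R) (p : T -> R[i]) : bounded_measurable p ->
  mu.-integrable setT (EFin \o (fun t => 2 * (1 - complex.Re (p t)))) /\
  Rintegral mu setT (fun t => 2 * (1 - complex.Re (p t))) =
    2 * (1 - complex.Re (cexpect mu p)).
Proof.
move=> bp.
(* A complex-valued version of the tangle, written with a scalar multiple so that the linearity of
   [cexpect] applies. *)
pose q t := 2 * (1 + (-1) * p t).
have bq : bounded_measurable q.
  do 2 (apply: bounded_measurableM || apply: bounded_measurableD);
    try apply: bounded_measurable_cst.
  by apply: bounded_measurableM => //; apply: bounded_measurable_cst.
have qE t : 2 * (1 - complex.Re (p t)) = complex.Re (q t).
  by rewrite /q mulN1r; case: (p t) => a b /=; ring.
have -> : (fun t => 2 * (1 - complex.Re (p t))) = (fun t => complex.Re (q t)).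
  by apply/funext => t; rewrite qE.
split; first exact: integrable_Re.
transitivity (complex.Re (cexpect mu q)) => //.
rewrite /q cexpectZ; last first.
  apply: bounded_measurableD; first exact: bounded_measurable_cst.
  by apply: bounded_measurableM => //; apply: bounded_measurable_cst.
rewrite cexpectD; [|exact: bounded_measurable_cst|].
  rewrite cexpect_cst cexpectZ //; case: (cexpect mu p) => a b /=; ring.
by apply: bounded_measurableM => //; apply: bounded_measurable_cst.
Qed.

Section AverageTangle.
Context {R : realType} {e1 e2 e3 : measure_display}.
Context {T1 : measurableType e1} {T2 : measurableType e2} {T3 : measurableType e3}.
Variables (P1 : probability T1 R) (P2 : probability T2 R) (P3 : probability T3 R).
Variables (d1 d2 d3 : nat).
Variables (psi1 : T1 -> 'cV[R[i]]_d1) (psi2 : T2 -> 'cV[R[i]]_d2)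
  (psi3 : T3 -> 'cV[R[i]]_d3).
Hypotheses (h1 : haar_random_state P1 psi1) (h2 : haar_random_state P2 psi2)
  (h3 : haar_random_state P3 psi3).
Hypotheses (d10 : (0 < d1)%N) (d20 : (0 < d2)%N) (d30 : (0 < d3)%N).
Variables (U : 'M[R[i]]_(d1 * d2 * d3)) (hU : U \is unitarymx).

(** The bound for any cut of the output space given by [idx]: the amplitudes of [U] on a product
    state form a [product_amplitude], so the purity bound for three factors applies. *)
Lemma Rintegral_tangle_le (A B : finType) (idx : A -> B -> 'I_(d1 * d2 * d3)) :
  (forall X : 'I_(d1 * d2 * d3) -> R[i], \sum_a \sum_b X (idx a b) = \sum_n X n) ->
  (0 < #|A|)%N -> (0 < #|B|)%N ->
  let p := fun t : T1 * T2 * T3 => quartic (fun a b =>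
     (U *m psep (psi1 t.1.1) (psi2 t.1.2) (psi3 t.2)) (idx a b) 0) in
  ((P1 \x P2) \x P3)%E.-integrable setT (EFin \o (fun t => 2 * (1 - complex.Re (p t)))) /\
  Rintegral ((P1 \x P2) \x P3)%E setT (fun t => 2 * (1 - complex.Re (p t))) <=
    eps_tilde R d1 d2 d3 #|A| #|B|.
Proof.
move=> hidx A0 B0 p.
pose F a b i1 i2 i3 := U (idx a b) (idx3 i1 i2 i3).
have pE : p = (fun t => quartic (product_amplitude psi1 psi2 psi3 F t)).
  apply/funext => t; apply: eq_quartic => a b.
  rewrite /product_amplitude mxE sum_idx3; apply: eq_bigr => i3 _.
  rewrite mulr_suml; apply: eq_bigr => i2 _.
  rewrite !mulr_suml; apply: eq_bigr => i1 _.
  by rewrite psep_idx3 /F; ring.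
have bp : bounded_measurable p.
  rewrite pE; apply: bounded_measurable_quartic => a b.
  exact: (bounded_measurable_product_amplitude h1 h2 h3 F a b).
have [ip ->] := Rintegral_tangle ((P1 \x P2) \x P3)%E bp.
split => //; rewrite eps_tildeE // ler_pM2l // lerD2l lerN2.
have := cexpect_quartic_ge3 h1 h2 h3 d10 d20 d30 F; rewrite -pE.
have -> : \sum_a \sum_b \sum_i3 \sum_i2 \sum_i1 `|F a b i1 i2 i3| ^+ 2 =
    (d1 * d2 * d3)%:R.
  rewrite -(unitarymx_sum_sqr hU) -hidx; apply: eq_bigr => a _; apply: eq_bigr => b _.
  by rewrite sum_idx3.
(* The order on [R[i]] compares real parts and equates imaginary parts; only the real part is kept,
   and the lower bound is the image of a real number. *)
rewrite lecE => /andP[_]; apply: le_trans; rewrite le_eqVlt; apply/orP; left; apply/eqP.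
set r := LHS.
transitivity (complex.Re (real_complex R r)) => //; congr complex.Re.
rewrite /r; do 4 rewrite rmorphM; rewrite rmorphXn rmorph_sum !fmorphV !rmorph_nat.
congr (_ * _ * _).
by apply: eq_bigr => x _; rewrite fmorphV rmorph_nat.
Qed.

End AverageTangle.

Unset Implicit Arguments.

Theorem theorem2 (R : realType) (d1 d2 d3 : nat)
  (hd1 : (0 < d1)%N) (hd2 : (0 < d2)%N) (hd3 : (0 < d3)%N)
  (U : 'M[R[i]]_(d1 * d2 * d3)) (hU : U \is unitarymx)
  (e1 e2 e3 : measure_display)
  (T1 : measurableType e1) (T2 : measurableType e2) (T3 : measurableType e3)
  (P1 : probability T1 R) (P2 : probability T2 R) (P3 : probability T3 R)
  (psi1 : T1 -> 'cV[R[i]]_d1) (psi2 : T2 -> 'cV[R[i]]_d2)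
  (psi3 : T3 -> 'cV[R[i]]_d3)
  (h1 : haar_random_state P1 psi1) (h2 : haar_random_state P2 psi2)
  (h3 : haar_random_state P3 psi3) :
  let phi := fun t : T1 * T2 * T3 =>
    U *m psep (psi1 t.1.1) (psi2 t.1.2) (psi3 t.2) in
  let mu := ((P1 \x P2) \x P3)%E in
  [/\ (\int[mu]_t (tau12_3 (phi t))%:E <= (eps_tilde12_3 R d1 d2 d3)%:E)%E,
      (\int[mu]_t (tau13_2 (phi t))%:E <= (eps_tilde13_2 R d1 d2 d3)%:E)%E,
      (\int[mu]_t (tau23_1 (phi t))%:E <= (eps_tilde23_1 R d1 d2 d3)%:E)%E &
      (\int[mu]_t (tau1 (phi t))%:E <= (eps_tilde1 R d1 d2 d3)%:E)%E].
Proof.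
move=> phi mu.
(* The same measure as [mu], packaged as a probability so that the lemmas on probabilities apply. *)
pose m := ((P1 \x P2) \x P3)%E : probability _ R.
have pos p q : (0 < p -> 0 < q -> 0 < #|{: 'I_p * 'I_q}|)%N.
  by move=> p0 q0; rewrite card_prod !card_ord muln_gt0 p0.
have cardI p : (0 < p -> 0 < #|'I_p|)%N by rewrite card_ord.
have [i12 b12] := Rintegral_tangle_le h1 h2 h3 hd1 hd2 hd3 hU
  (idx := fun (a : 'I_d1 * 'I_d2) b => idx3 a.1 a.2 b)
  (@sum_idx3_12 _ _ _ _) (pos _ _ hd1 hd2) (cardI _ hd3).
have [i13 b13] := Rintegral_tangle_le h1 h2 h3 hd1 hd2 hd3 hU
  (idx := fun (a : 'I_d1 * 'I_d3) b => idx3 a.1 b a.2)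
  (@sum_idx3_13 _ _ _ _) (pos _ _ hd1 hd3) (cardI _ hd2).
have [i23 b23] := Rintegral_tangle_le h1 h2 h3 hd1 hd2 hd3 hU
  (idx := fun (a : 'I_d2 * 'I_d3) b => idx3 b a.1 a.2)
  (@sum_idx3_23 _ _ _ _) (pos _ _ hd2 hd3) (cardI _ hd1).
have f12 : (fun t => tau12_3 (phi t)) = (fun t => 2 * (1 - complex.Re (quartic
    (fun (a : 'I_d1 * 'I_d2) b => phi t (idx3 a.1 a.2 b) 0)))).
  by apply/funext => t; rewrite tau12_3_quartic.
have f13 : (fun t => tau13_2 (phi t)) = (fun t => 2 * (1 - complex.Re (quartic
    (fun (a : 'I_d1 * 'I_d3) b => phi t (idx3 a.1 b a.2) 0)))).
  by apply/funext => t; rewrite tau13_2_quartic.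
have f23 : (fun t => tau23_1 (phi t)) = (fun t => 2 * (1 - complex.Re (quartic
    (fun (a : 'I_d2 * 'I_d3) b => phi t (idx3 b a.1 a.2) 0)))).
  by apply/funext => t; rewrite tau23_1_quartic.
rewrite -f12 card_prod !card_ord in i12 b12.
rewrite -f13 card_prod !card_ord in i13 b13.
rewrite -f23 card_prod !card_ord in i23 b23.
have iD (f g : T1 * T2 * T3 -> R) : m.-integrable setT (EFin \o f) ->
    m.-integrable setT (EFin \o g) -> m.-integrable setT (EFin \o (fun t => f t + g t)).
  by move=> fi gi; apply: eq_integrable (integrableD measurableT fi gi).
have i123 := iD _ _ (iD _ _ i12 i13) i23.
split.
- by rewrite (RintegralE (mu := m) i12) lee_fin.
- by rewrite (RintegralE (mu := m) i13) lee_fin.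
- by rewrite (RintegralE (mu := m) i23) lee_fin.
(* Integrability makes the extended-real integral finite, so it equals [Rintegral], whose linearity
   splits the one-tangle into the three cuts. *)
have i1 : m.-integrable setT (EFin \o (fun t => tau1 (phi t))).
  have := integrableZl measurableT 3^-1 i123; apply: eq_integrable => // t _ /=.
  by rewrite /tau1 -EFinM mulrC.
rewrite (RintegralE (mu := m) i1) lee_fin /tau1 RintegralZr // RintegralD //; last exact: iD.
rewrite RintegralD // /eps_tilde1 ler_pM2r ?invr_gt0 //.
by apply: lerD => //; apply: lerD.
Qed.
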